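(* Let $f:\mathbb{R}^n\to\mathbb{R}$, $g:\mathbb{R}^m\to\mathbb{R}$, $Q:\mathbb{R}^n\times\mathbb{R}^m\to\mathbb{R}\cup\{+\infty\}$ and $L(x,y)=f(x)+Q(x,y)+g(y)$ satisfy: (A1) $L$ is bounded below; $f,g$ are continuously differentiable with $\nabla f$, $\nabla g$ Lipschitz continuous with constants $L_{\nabla f}$, $L_{\nabla g}$; $Q$ is proper and lower semicontinuous; $\phi_1:\mathbb{R}^n\to\mathbb{R}$, $\phi_2:\mathbb{R}^m\to\mathbb{R}$ are differentiable, $\phi_i$ is $\theta_i$-strongly convex with $\theta_1>L_{\nabla f}$, $\theta_2>L_{\nabla g}$, and $\nabla\phi_i$ is $\eta_i$-Lipschitz continuous ($i=1,2$); (A2) $L$ is coercive and $\mathrm{dom}\,Q$ is closed; for all $(x,y)\in\mathrm{dom}\,Q$, $\partial_xQ(x,y)\times\partial_yQ(x,y)\subset\partial Q(x,y)$; and $Q(x,y)=q(x,y)+h(x)$, where $h:\mathbb{R}^n\to\mathbb{R}\cup\{+\infty\}$ is continuous on its domain, $q$ is continuous on $\mathrm{dom}\,Q$, for every $y$ the partial function $q(\cdot,y)$ is continuously differentiable, and for each bounded subset $D_1\times D_2\subset\mathrm{dom}\,Q$ there exists $\xi>0$ such that $\|\nabla_xq(\bar x,y)-\nabla_xq(\bar x,\bar y)\|\le\xi\|y-\bar y\|$ for all $\bar x\in D_1$, $y,\bar y\in D_2$. Assume moreover that $L$ is a Kurdyka–Łojasiewicz (KŁ) function. Let $z_k=(x_k,y_k)$,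 together with $(\hat x_k,\hat y_k)$, be generated by the following algorithm with initial point $z_0=(x_0,y_0)$: set $(\hat x_0,\hat y_0)=(x_0,y_0)$, choose $\alpha_{\max},\beta_{\max}\ge0$ with $\alpha_{\max}+\beta_{\max}<1$ and $\alpha_k\in[0,\alpha_{\max}]$, $\beta_k\in[0,\beta_{\max}]$; for $k=0,1,\dots$: 1. $x_{k+1}\in\arg\min_{x}\{Q(x,\hat y_k)+\langle\nabla f(\hat x_k),x\rangle+D_{\phi_1}(x,\hat x_k)\}$, $y_{k+1}\in\arg\min_{y}\{Q(x_{k+1},y)+\langle\nabla g(\hat y_k),y\rangle+D_{\phi_2}(y,\hat y_k)\}$; 2. $u_{k+1}=x_{k+1}+\alpha_k(x_{k+1}-x_k)+\beta_k(x_k-x_{k-1})$, $v_{k+1}=y_{k+1}+\alpha_k(y_{k+1}-y_k)+\beta_k(y_k-y_{k-1})$; 3. if $L(u_{k+1},v_{k+1})\le L(x_{k+1},y_{k+1})$ then $(\hat x_{k+1},\hat y_{k+1})=(u_{k+1},v_{k+1})$, else $(\hat x_{k+1},\hat y_{k+1})=(x_{k+1},y_{k+1})$. Then (i) $\sum_{k=0}^\infty\|z_{k+1}-z_k\|<\infty$, and (ii) the sequence $\{z_k\}$ converges to a critical point of $L$.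
   Context: For a convex differentiable $\phi$, $D_\phi(x,y)=\phi(x)-\phi(y)-\langle\nabla\phi(y),x-y\rangle$ (Bregman distance). $\phi$ is $\theta$-strongly convex if $\phi-\frac\theta2\|\cdot\|^2$ is convex. For a proper lsc $F$, the Fréchet subdifferential $\hat\partial F(x)$ is the set of $v$ with $\liminf_{y\to x}\frac{F(y)-F(x)-\langle v,y-x\rangle}{\|y-x\|}\ge0$ (empty if $x\notin\mathrm{dom}F$), and the (limiting) subdifferential is $\partial F(x)=\{v:\exists x_k\to x, F(x_k)\to F(x), v_k\in\hat\partial F(x_k), v_k\to v\}$; $\partial_xQ$, $\partial_yQ$ are the limiting subdifferentials of the partial functions. A critical point of $L$ is $z$ with $0\in\partial L(z)$. A proper lsc $F$ has the KŁ property at $x^\ast\in\mathrm{dom}\,F$ if there exist $\eta\in(0,+\infty]$, a neighborhood $U$ of $x^\ast$ and a continuous concave $\varphi:[0,\eta)\to\mathbb{R}_+$ with $\varphi(0)=0$, $\varphi$ $C^1$ on $(0,\eta)$, $\varphi'>0$ on $(0,\eta)$, such that $\varphi'(F(x)-F(x^\ast))\,\mathrm{dist}(0,\partial F(x))\ge1$ for all $x\in U$ with $F(x^\ast)<F(x)<F(x^\ast)+\eta$; $F$ is a KŁ function if it has the KŁ property at every point of its domain. $(x_{-1},y_{-1})$ in step 2 is a given initial point (e.g. $(x_0,y_0)$). *)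

(* Defs.v *)
From HB Require Import structures.
From mathcomp Require Import all_boot all_order all_algebra.
From mathcomp Require Import all_classical all_reals all_analysis.
Set Implicit Arguments. Unset Strict Implicit. Unset Printing Implicit Defensive.
Import Order.TTheory GRing.Theory Num.Theory.
Import numFieldNormedType.Exports.
Local Open Scope classical_set_scope.
Local Open Scope ring_scope.

Section Defs.
Variable R : realType.

Definition dotv k (u v : 'rV[R]_k) : R := \sum_(i < k) u ord0 i * v ord0 i.
Definition enorm k (u : 'rV[R]_k) : R := Num.sqrt (dotv u u).

(* R^n x R^m is identified with R^(n+m) via row_mx; the Euclidean norm on
   R^(n+m) is the product Euclidean norm. *)
Definition pairv n m (x : 'rV[R]_n) (y : 'rV[R]_m) : 'rV[R]_(n + m) := row_mx x y.
Definition uncurryv n m T (F : 'rV[R]_n -> 'rV[R]_m -> T) : 'rV[R]_(n + m) -> T :=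
  fun z => F (lsubmx z) (rsubmx z).

Definition cvgv k (u : nat -> 'rV[R]_k) (l : 'rV[R]_k) : Prop :=
  forall eps : R, 0 < eps -> exists N : nat, forall j, (N <= j)%N -> enorm (u j - l) < eps.

Definition dom_ext k (F : 'rV[R]_k -> \bar R) : set 'rV[R]_k := [set x | (F x < +oo)%E].

Definition proper_ext k (F : 'rV[R]_k -> \bar R) : Prop :=
  (forall x, F x != -oo%E) /\ exists x, (F x < +oo)%E.

Definition lsc_ext k (F : 'rV[R]_k -> \bar R) : Prop :=
  forall x (a : R), (a%:E < F x)%E ->
    exists2 d : R, 0 < d & forall y, enorm (y - x) < d -> (a%:E < F y)%E.

Definition closedv k (A : set 'rV[R]_k) : Prop :=
  forall z, (forall eps : R, 0 < eps -> exists2 w, A w & enorm (w - z) < eps) -> A z.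

Definition boundedv k (A : set 'rV[R]_k) : Prop :=
  exists r : R, forall z, A z -> enorm z <= r.

Definition coercive_ext k (F : 'rV[R]_k -> \bar R) : Prop :=
  forall M : R, exists r : R, forall z, r < enorm z -> (M%:E < F z)%E.

Definition lipschitzv k l (G : 'rV[R]_k -> 'rV[R]_l) (c : R) : Prop :=
  0 <= c /\ forall x y, enorm (G x - G y) <= c * enorm (x - y).

Definition continuousv k l (G : 'rV[R]_k -> 'rV[R]_l) : Prop :=
  forall x (eps : R), 0 < eps -> exists2 d : R, 0 < d &
    forall y, enorm (y - x) < d -> enorm (G y - G x) < eps.

Definition is_gradient k (F : 'rV[R]_k -> R) (gF : 'rV[R]_k -> 'rV[R]_k) : Prop :=
  forall x (eps : R), 0 < eps -> exists2 d : R, 0 < d &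
    forall y, enorm (y - x) < d ->
      `|F y - F x - dotv (gF x) (y - x)| <= eps * enorm (y - x).

Definition convexv k (F : 'rV[R]_k -> R) : Prop :=
  forall x y (t : R), 0 <= t <= 1 ->
    F (t *: x + (1 - t) *: y) <= t * F x + (1 - t) * F y.

Definition strongly_convex k (theta : R) (F : 'rV[R]_k -> R) : Prop :=
  convexv (fun x => F x - theta / 2 * enorm x ^+ 2).

Definition bregman k (phi : 'rV[R]_k -> R) (gphi : 'rV[R]_k -> 'rV[R]_k)
  (x y : 'rV[R]_k) : R := phi x - phi y - dotv (gphi y) (x - y).

(* Frechet subdifferential: liminf_{y->x} (F y - F x - <v,y-x>)/||y-x|| >= 0,
   written out; empty outside dom F. *)
Definition frechet_subdiff k (F : 'rV[R]_k -> \bar R) (x : 'rV[R]_k) : set 'rV[R]_k :=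
  [set v | F x \is a fin_num /\
     forall eps : R, 0 < eps -> exists2 d : R, 0 < d &
       forall y, enorm (y - x) < d ->
         ((fine (F x) + dotv v (y - x) - eps * enorm (y - x))%:E <= F y)%E].

Definition limiting_subdiff k (F : 'rV[R]_k -> \bar R) (x : 'rV[R]_k) : set 'rV[R]_k :=
  [set v | exists (xs vs : nat -> 'rV[R]_k),
     [/\ cvgv xs x,
         F x \is a fin_num,
         (forall eps : R, 0 < eps -> exists N : nat, forall j, (N <= j)%N ->
            `|fine (F (xs j)) - fine (F x)| < eps),
         (forall j, frechet_subdiff F (xs j) (vs j)) &
         cvgv vs v]].

Definition critical_point k (F : 'rV[R]_k -> \bar R) (z : 'rV[R]_k) : Prop :=
  limiting_subdiff F z 0.

(* dist(0, S) in \bar R, = +oo for S empty *)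
Definition dist0 k (S : set 'rV[R]_k) : \bar R :=
  ereal_inf [set (enorm v)%:E | v in S].

Definition KL_at k (F : 'rV[R]_k -> \bar R) (xs : 'rV[R]_k) : Prop :=
  dom_ext F xs /\
  exists (eta : \bar R) (delta : R) (varphi : R -> R),
    [/\ (0 < eta)%E /\ 0 < delta,
        ({within [set s : R | 0 <= s /\ (s%:E < eta)%E], continuous varphi} /\
         (forall a b (t : R), 0 <= a -> (a%:E < eta)%E -> 0 <= b -> (b%:E < eta)%E ->
            0 <= t <= 1 -> t * varphi a + (1 - t) * varphi b <= varphi (t * a + (1 - t) * b))),
        (varphi 0 = 0 /\ (forall s, 0 <= s -> (s%:E < eta)%E -> 0 <= varphi s)),
        (forall s, 0 < s -> (s%:E < eta)%E ->
           [/\ derivable varphi s 1, ({for s, continuous (derive1 varphi)}) & 0 < derive1 varphi s]) &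
        (forall x, enorm (x - xs) < delta -> (F xs < F x)%E -> (F x < F xs + eta)%E ->
           ((derive1 varphi (fine (F x - F xs)))%:E * dist0 (limiting_subdiff F x) >= 1)%E)].

Definition KL_function k (F : 'rV[R]_k -> \bar R) : Prop :=
  forall x, dom_ext F x -> KL_at F x.

Definition Lobj n m (f : 'rV[R]_n -> R) (Q : 'rV[R]_n -> 'rV[R]_m -> \bar R)
  (g : 'rV[R]_m -> R) (x : 'rV[R]_n) (y : 'rV[R]_m) : \bar R :=
  ((f x)%:E + Q x y + (g y)%:E)%E.

Definition continuous_on_set k (F : 'rV[R]_k -> R) (A : set 'rV[R]_k) : Prop :=
  forall x (eps : R), A x -> 0 < eps -> exists2 d : R, 0 < d &
    forall y, A y -> enorm (y - x) < d -> `|F y - F x| < eps.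

(* the sequence shifted by one, with prescribed value at index -1:
   prevseq u um1 k = u_(k-1), with u_(-1) = um1 *)
Definition prevseq T (u : nat -> T) (um1 : T) (k : nat) : T :=
  if k is k'.+1 then u k' else um1.

End Defs.

(* Main.v *)
(** The three facts the Kurdyka-Lojasiewicz machinery needs hold from index 1 on
    (the starting point may lie outside the domain, and dom Q = dom h x R^m because
    q is real valued):
    - sufficient decrease: minimality in each block, the descent lemma for f and g and
      strong convexity of the kernels give L(z_{k+1}) + a |z_{k+1} - zh_k|^2 <= L(zh_k),
      and L(zh_k) <= L(z_k) by the safeguard of step 3;
    - subgradient bound: the optimality condition of the x-step lives at (x_{k+1}, yh_k);
      since Q = q + h, exchanging yh_k for y_{k+1} adds the difference of two gradients of
      q, so L has a subgradient of norm at most C |z_{k+1} - zh_k| at z_{k+1};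
    - continuity of L along the (bounded) sequence.
    With d_k = |z_{k+1} - zh_k|, e_k = |z_{k+1} - z_k| and p the desingularizing function
    at a cluster point z*, the KL inequality yields
    2 d_k <= d_{k-1} + M (p(L_k - L* ) - p(L_{k+1} - L* )) while z_k is near z*, and
    inertia yields e_k <= d_k + A e_{k-1} + B e_{k-2} with A + B < 1. Hence
      V_k = d_{k-1} + M p(L_k - L* ) + (A + B) e_{k-1} + B e_{k-2}
    satisfies (1 - A - B) e_k <= V_k - V_{k+1}, so (1 - A - B) |z_k - z*| + V_k is
    nonincreasing: once it is small it traps the sequence near z* and makes the lengths
    summable. *)
Require Import Defs.
From HB Require Import structures.
From mathcomp Require Import all_boot all_order all_algebra.
From mathcomp Require Import all_classical all_reals all_analysis.
From mathcomp Require Import ring lra.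
Import Order.TTheory GRing.Theory Num.Theory.
Import numFieldNormedType.Exports.
Local Open Scope classical_set_scope.
Local Open Scope ring_scope.

Set Implicit Arguments.
Unset Strict Implicit.

(** * Euclidean inner product and norm *)

Section Euclid.
Variables (R : realType) (k : nat).
Implicit Types (u v w : 'rV[R]_k) (a : R).

Lemma dotvC u v : dotv u v = dotv v u.
Proof. by apply: eq_bigr => i _; rewrite mulrC. Qed.

Lemma dotvDl u v w : dotv (u + v) w = dotv u w + dotv v w.
Proof. by rewrite -big_split; apply: eq_bigr => i _ /=; rewrite mxE mulrDl. Qed.

Lemma dotvZl a u v : dotv (a *: u) v = a * dotv u v.
Proof. by rewrite /dotv big_distrr; apply: eq_bigr => i _ /=; rewrite mxE mulrA. Qed.

Lemma dotvNl u v : dotv (- u) v = - dotv u v.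
Proof. by rewrite -scaleN1r dotvZl mulN1r. Qed.

Lemma dotvBl u v w : dotv (u - v) w = dotv u w - dotv v w.
Proof. by rewrite dotvDl dotvNl. Qed.

Lemma dotvDr u v w : dotv w (u + v) = dotv w u + dotv w v.
Proof. by rewrite !(dotvC w) dotvDl. Qed.

Lemma dotvZr a u v : dotv v (a *: u) = a * dotv v u.
Proof. by rewrite !(dotvC v) dotvZl. Qed.

Lemma dotvNr u v : dotv v (- u) = - dotv v u.
Proof. by rewrite !(dotvC v) dotvNl. Qed.

Lemma dotvBr u v w : dotv w (u - v) = dotv w u - dotv w v.
Proof. by rewrite dotvDr dotvNr. Qed.

Definition dotvE := (dotvDl, dotvDr, dotvNl, dotvNr, dotvZl, dotvZr).

Lemma dotvv_ge0 u : 0 <= dotv u u.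
Proof. by apply: sumr_ge0 => i _; rewrite -expr2 sqr_ge0. Qed.

Lemma enorm_ge0 u : 0 <= enorm u.
Proof. exact: sqrtr_ge0. Qed.

Lemma enorm_sqr u : enorm u ^+ 2 = dotv u u.
Proof. by rewrite sqr_sqrtr // dotvv_ge0. Qed.

Lemma enorm0 : enorm (0 : 'rV[R]_k) = 0.
Proof. by rewrite /enorm /dotv big1 ?sqrtr0 // => i _; rewrite mxE mul0r. Qed.

Lemma enormZ a u : enorm (a *: u) = `|a| * enorm u.
Proof.
by rewrite /enorm dotvZl dotvZr mulrA -expr2 sqrtrM ?sqr_ge0 // sqrtr_sqr.
Qed.

Lemma enormN u : enorm (- u) = enorm u.
Proof. by rewrite -scaleN1r enormZ normrN1 mul1r. Qed.

Lemma enormC u v : enorm (u - v) = enorm (v - u).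
Proof. by rewrite -enormN opprB. Qed.

Lemma coord_le_enorm u i : `|u ord0 i| <= enorm u.
Proof.
rewrite -sqrtr_sqr ler_sqrt ?dotvv_ge0// /dotv (bigD1 i) //= -expr2.
by rewrite lerDl sumr_ge0 // => j _; rewrite -expr2 sqr_ge0.
Qed.

Lemma enorm_eq0 u : enorm u = 0 -> u = 0.
Proof.
move=> u0; apply/rowP => i; rewrite mxE; apply/eqP.
by rewrite -normr_le0 -u0 coord_le_enorm.
Qed.

(** Multiplied by [enorm v ^+ 2], the gap between the two squared sides is the squared norm of
    [enorm v ^+ 2 *: u - dotv u v *: v]. *)
Lemma cauchy_schwarz u v : `|dotv u v| <= enorm u * enorm v.
Proof.
have [v0|v0] := eqVneq (enorm v) 0.
  rewrite v0 (enorm_eq0 v0) mulr0 normr_le0 /dotv big1 // => i _.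
  by rewrite mxE mulr0.
have vp : 0 < enorm v by rewrite lt_neqAle eq_sym v0 enorm_ge0.
rewrite -(@ler_pXn2r _ 2) ?nnegrE ?mulr_ge0 ?enorm_ge0 //.
rewrite real_normK ?num_real // exprMn -subr_ge0.
rewrite -(pmulr_rge0 _ (exprn_gt0 2 vp)) (_ : _ * _ =
  dotv (enorm v ^+ 2 *: u - dotv u v *: v) (enorm v ^+ 2 *: u - dotv u v *: v)).
  exact: dotvv_ge0.
by rewrite !dotvE (dotvC v u) !enorm_sqr; ring.
Qed.

Lemma dotv_le u v : dotv u v <= enorm u * enorm v.
Proof. exact: le_trans (ler_norm _) (cauchy_schwarz _ _). Qed.

Lemma ler_enormD u v : enorm (u + v) <= enorm u + enorm v.
Proof.
rewrite -(@ler_pXn2r _ 2) ?nnegrE ?addr_ge0 ?enorm_ge0 //.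
rewrite sqrrD !enorm_sqr !dotvE (dotvC v u).
by have := dotv_le u v; lra.
Qed.

Lemma ler_enorm_dist w u v : enorm (u - v) <= enorm (u - w) + enorm (w - v).
Proof. by rewrite -{1}(subrK w u) -addrA ler_enormD. Qed.

End Euclid.

(** * The product space as concatenated row vectors *)

Section Pairs.
Variables (R : realType) (n m : nat).
Implicit Types (u : 'rV[R]_n) (v : 'rV[R]_m) (w : 'rV[R]_(n + m)).

Lemma pairvB u u' v v' : pairv u v - pairv u' v' = pairv (u - u') (v - v').
Proof. by rewrite /pairv opp_row_mx add_row_mx. Qed.

Lemma pairvD u u' v v' : pairv u v + pairv u' v' = pairv (u + u') (v + v').
Proof. by rewrite /pairv add_row_mx. Qed.

Lemma pairvZ (a : R) u v : a *: pairv u v = pairv (a *: u) (a *: v).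
Proof. by rewrite /pairv scale_row_mx. Qed.

Lemma dotv_pairv u v u' v' : dotv (pairv u v) (pairv u' v') = dotv u u' + dotv v v'.
Proof.
rewrite /dotv big_split_ord /=; congr (_ + _); apply: eq_bigr => i _.
  by rewrite !row_mxEl.
by rewrite !row_mxEr.
Qed.

Lemma uncurryv_pairv T (F : 'rV[R]_n -> 'rV[R]_m -> T) u v :
  uncurryv F (pairv u v) = F u v.
Proof. by rewrite /uncurryv /pairv row_mxKl row_mxKr. Qed.

Lemma pairv_sub w : pairv (lsubmx w) (rsubmx w) = w.
Proof. exact: hsubmxK. Qed.

Lemma enorm_pairv_sqr u v : enorm (pairv u v) ^+ 2 = enorm u ^+ 2 + enorm v ^+ 2.
Proof. by rewrite !enorm_sqr dotv_pairv. Qed.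

Lemma enorm_pairv_le u v : enorm (pairv u v) <= enorm u + enorm v.
Proof.
rewrite -(@ler_pXn2r _ 2) ?nnegrE ?addr_ge0 ?enorm_ge0 //.
rewrite enorm_pairv_sqr sqrrD.
by have := mulr_ge0 (enorm_ge0 u) (enorm_ge0 v); lra.
Qed.

Lemma enorm_pairv_gel u v : enorm u <= enorm (pairv u v).
Proof.
by rewrite -(@ler_pXn2r _ 2) ?nnegrE ?enorm_ge0 // enorm_pairv_sqr lerDl sqr_ge0.
Qed.

Lemma enorm_pairv_ger u v : enorm v <= enorm (pairv u v).
Proof.
by rewrite -(@ler_pXn2r _ 2) ?nnegrE ?enorm_ge0 // enorm_pairv_sqr lerDr sqr_ge0.
Qed.

End Pairs.

(** * Descent lemma and strong convexity in terms of Bregman distances *)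

Section Smooth.
Variables (R : realType) (k : nat).
Implicit Types (F : 'rV[R]_k -> R) (gF : 'rV[R]_k -> 'rV[R]_k).

(** Restriction to a line turns the epsilon-delta gradient into a one-variable derivative, to which
    the mean value theorem applies. *)
Lemma is_derive_line F gF (x d : 'rV[R]_k) (t : R) : is_gradient F gF ->
  is_derive t (1 : R) (fun s : R => F (x + s *: d)) (dotv (gF (x + t *: d)) d).
Proof.
move=> HF.
suff cv : (h : R)^-1 *: (F (x + (h *: (1:R) + t) *: d) - F (x + t *: d))
    @[h --> (0:R)^'] --> dotv (gF (x + t *: d)) d.
  by apply: DeriveDef; [apply/cvg_ex; eexists; exact: cv | exact: cvg_lim cv].
apply/cvgrPdist_le => e e0.
(* The [+ 1] keeps the quotients below meaningful when [d] is zero. *)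
have d1 : 0 < enorm d + 1 by have := enorm_ge0 d; lra.
have [r r0 Hr] := HF (x + t *: d) (e / (enorm d + 1)) (divr_gt0 e0 d1).
near=> h.
have h0 : h != 0 by near: h; exact: nbhs_dnbhs_neq.
have hr : `|h| < r / (enorm d + 1).
  near: h; apply: dnbhs0_lt; exact: divr_gt0.
have E : x + (h *: (1:R) + t) *: d - (x + t *: d) = h *: d.
  rewrite scalerDl [X in x + (X + _)](_ : _ = h *: d); last first.
    by rewrite -[h *: (1:R)]/(h * 1) mulr1.
  by rewrite opprD addrACA subrr add0r addrK.
have /Hr : enorm (x + (h *: (1:R) + t) *: d - (x + t *: d)) < r.
  rewrite E enormZ; apply: le_lt_trans (_ : `|h| * (enorm d + 1) < r).
    by rewrite ler_wpM2l // lerDl.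
  by rewrite -ltr_pdivlMr.
rewrite E enormZ dotvZr => H.
rewrite distrC -(@ler_pM2l _ `|h|) ?normr_gt0 // -normrM mulrBr.
rewrite -[h * (_ *: _)]/(h * (_ * _)) mulrA divff // mul1r.
apply: (le_trans H); rewrite mulrCA ler_wpM2l // mulrAC -mulrA.
by apply: ler_piMr; [exact: ltW | rewrite ler_pdivrMr // mul1r lerDl].
Unshelve. all: by end_near.
Qed.

(** No integral is used: along the segment, [F] minus its quadratic model at [x] has a derivative
    that the Lipschitz bound makes nonpositive, so the mean value theorem gives [G 1 <= G 0]. *)
Lemma descent_lemma F gF (L : R) : is_gradient F gF -> lipschitzv gF L ->
  forall x y, F y <= F x + dotv (gF x) (y - x) + L / 2 * enorm (y - x) ^+ 2.
Proof.
move=> HF [L0 HL] x y; set d := y - x.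
pose G (s : R) := F (x + s *: d) - (s * dotv (gF x) d + s ^+ 2 * (L / 2 * enorm d ^+ 2)).
have dG t : is_derive t (1 : R) G (dotv (gF (x + t *: d)) d -
    (dotv (gF x) d + 2 * t * (L / 2 * enorm d ^+ 2))).
  have DF := is_derive_line x d t HF.
  apply: is_derive_eq.
  by rewrite /GRing.scale /=; ring.
have cG : {within `[(0:R), 1], continuous G}.
  by apply: derivable_within_continuous => t _; have [] := dG t.
have [c] := MVT (@ltr01 R) (fun t _ => dG t) cG.
rewrite in_itv /= => /andP[c0 c1].
rewrite /G scale1r scale0r addr0 subrKC subr0 mulr1 => H.
have := dotv_le (gF (x + c *: d) - gF x) d.
have := HL (x + c *: d) x; rewrite addrAC subrr add0r enormZ gtr0_norm //.
rewrite dotvBl => /(ler_wpM2r (enorm_ge0 d)) H1 H2.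
have : dotv (gF (x + c *: d)) d - dotv (gF x) d <= L * c * enorm d ^+ 2.
  by apply: le_trans H2 (le_trans H1 _); rewrite expr2 !mulrA.
move: H; lra.
Qed.

(** Write the convexity of [F - theta / 2 * enorm ^+ 2] between [x] and [y] with weight [t], expand
    [F] to first order at [y], divide by [t] and let [t] tend to 0. The limit is replaced by one
    explicit small [t] and a slack [e]. *)
Lemma bregman_ge F gF (theta : R) : is_gradient F gF -> strongly_convex theta F ->
  forall x y, theta / 2 * enorm (x - y) ^+ 2 <= bregman F gF x y.
Proof.
move=> HF Hc x y; rewrite /bregman; set d := x - y.
apply/ler_addgt0Pr => e e0.
pose T := `|theta / 2 * enorm d ^+ 2|.
have T0 : 0 <= T by exact: normr_ge0.
have d0 := enorm_ge0 d.
have e2 : 0 < e / 2 / (enorm d + 1) by rewrite !divr_gt0 //; lra.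
have [r r0 Hr] := HF y _ e2.
(* With this weight the combination stays within [r] of [y], and the second-order term costs at most
   [e / 2]; the other half of [e] pays for the remainder of the first-order expansion. *)
pose t := Num.min 1 (Num.min (r / 2 / (enorm d + 1)) (e / 2 / (T + 1))).
have t0 : 0 < t by rewrite !lt_min ltr01 !divr_gt0 //; lra.
have t1 : t <= 1 by rewrite ge_min lexx.
have tr : t * (enorm d + 1) <= r / 2.
  by rewrite -ler_pdivlMr; [rewrite !ge_min lexx orbT|lra].
have te : t * (T + 1) <= e / 2.
  by rewrite -ler_pdivlMr; [rewrite !ge_min lexx !orbT|lra].
have E : t *: x + (1 - t) *: y - y = t *: d by apply/rowP => i; rewrite !mxE; ring.
have /Hr : enorm (t *: x + (1 - t) *: y - y) < r.
  rewrite E.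
  by rewrite enormZ (gtr0_norm t0); move: tr; rewrite mulrDr mulr1; lra.
rewrite E enormZ (gtr0_norm t0) dotvZr ler_norml => /andP[H1 _].
have := Hc x y t; rewrite ltW // t1 => /(_ isT).
have -> : enorm (t *: x + (1 - t) *: y) ^+ 2 =
   t * enorm x ^+ 2 + (1 - t) * enorm y ^+ 2 - t * (1 - t) * enorm d ^+ 2.
  by rewrite !enorm_sqr /d !dotvE (dotvC y x); ring.
move=> H2.
have H3 : e / 2 / (enorm d + 1) * (t * enorm d) <= t * (e / 2).
  rewrite mulrCA ler_pM2l // mulrAC -mulrA ler_piMr //; first by lra.
  by rewrite ler_pdivrMr; lra.
have H4 : t * (theta / 2 * (1 - t) * enorm d ^+ 2) <=
    t * (F x - F y - dotv (gF y) d + e / 2) by move: H1 H2 H3; lra.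
move: H4; rewrite ler_pM2l // => H4.
have : t * (theta / 2 * enorm d ^+ 2) <= t * T by rewrite ler_pM2l // ler_norm.
move: te H4; lra.
Qed.

End Smooth.

(** For a concave function the slope at the right end of a chord is at most the slope of the chord:
    the left difference quotients at [s] are. Differentiability is asked at [s] only, since [r] will
    be the next value gap, which may be 0. *)
Lemma concave_gradient (R : realType) (p : R -> R) (r s : R) :
  derivable p s 1 -> r <= s ->
  (forall t, 0 <= t <= 1 -> t * p r + (1 - t) * p s <= p (t * r + (1 - t) * s)) ->
  derive1 p s * (s - r) <= p s - p r.
Proof.
move=> ds rs Hc.
have [->|rn] := eqVneq r s; first by rewrite !subrr mulr0.
have {rn}rs : 0 < s - r by rewrite subr_gt0 lt_neqAle rn.
rewrite -ler_pdivlMr //; apply/ler_addgt0Pr => e e0.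
move/cvg_ex: (ds) => [l Hl].
have El : derive1 p s = l by rewrite derive1E; exact: cvg_lim Hl.
move/cvgrPdist_le: Hl => /(_ e e0).
move=> -[d /= d0 Hd].
pose t := Num.min 1 (d / 2 / (s - r)).
have t0 : 0 < t by rewrite lt_min ltr01 !divr_gt0.
have t1 : t <= 1 by rewrite ge_min lexx.
have td : t * (s - r) <= d / 2 by rewrite -ler_pdivlMr // ge_min lexx orbT.
have tsr : 0 < t * (s - r) by exact: mulr_gt0.
have tn : - (t * (s - r)) != 0 by rewrite oppr_eq0 gt_eqF.
have := Hd (- (t * (s - r))); rewrite /= sub0r opprK gtr0_norm //.
have -> : t * (s - r) < d by lra.
move=> /(_ isT tn); rewrite El distrC ler_norml => /andP[H1 _].
have := Hc t; rewrite ltW // t1 => /(_ isT) H2.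
have E : - (t * (s - r)) *: (1:R) + s = t * r + (1 - t) * s.
  by rewrite /GRing.scale /=; ring.
move: H1; rewrite E /GRing.scale /= invrN mulNr.
suff : (p s - p r) / (s - r) >= - ((t * (s - r))^-1 * (p (t * r + (1 - t) * s) - p s)).
  by lra.
rewrite ler_pdivlMr //.
rewrite [leLHS](_ : _ = (p s - p (t * r + (1 - t) * s)) / t); last by field; rewrite ?gt_eqF.
by rewrite ler_pdivrMr //; lra.
Qed.

(** * Calculus of Fréchet and limiting subdifferentials *)

Section Subdifferential.
Variables (R : realType) (k : nat).
Implicit Types (F : 'rV[R]_k -> \bar R) (G : 'rV[R]_k -> R) (u v : nat -> 'rV[R]_k).

Lemma is_gradientB G G' gG gG' : is_gradient G gG -> is_gradient G' gG' ->
  is_gradient (fun x => G x - G' x) (fun x => gG x - gG' x).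
Proof.
move=> HG HG' x e e0; have e2 : 0 < e / 2 by rewrite divr_gt0.
have [d d0 Hd] := HG x _ e2; have [d' d'0 Hd'] := HG' x _ e2.
exists (Num.min d d'); first by rewrite lt_min d0.
move=> y; rewrite lt_min => /andP[/Hd H /Hd' H'].
rewrite dotvBl (_ : _ - _ = (G y - G x - dotv (gG x) (y - x)) -
  (G' y - G' x - dotv (gG' x) (y - x))); last by ring.
apply: le_trans (ler_normB _ _) _; lra.
Qed.

Lemma gradient_continuous G gG x (e : R) : is_gradient G gG -> 0 < e ->
  exists2 d : R, 0 < d & forall y, enorm (y - x) < d -> `|G y - G x| < e.
Proof.
move=> HG e0; have [d d0 Hd] := HG x _ ltr01.
have a0 := enorm_ge0 (gG x).
have E0 : 0 < e / (2 + enorm (gG x)) by rewrite divr_gt0 //; lra.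
exists (Num.min d (e / (2 + enorm (gG x)))); first by rewrite lt_min d0.
move=> y; rewrite lt_min => /andP[/Hd H]; rewrite ltr_pdivlMr; last by lra.
rewrite mulrDr => H'.
rewrite (_ : _ - _ = (G y - G x - dotv (gG x) (y - x)) + dotv (gG x) (y - x)); last by ring.
apply: le_lt_trans (ler_normD _ _) _.
by have := cauchy_schwarz (gG x) (y - x); have := enorm_ge0 (y - x); lra.
Qed.

Lemma lipschitzv_continuous l (T : 'rV[R]_k -> 'rV[R]_l) (c : R) :
  lipschitzv T c -> continuousv T.
Proof.
move=> [c0 H] x e e0; have c1 : 0 < c + 1 by lra.
exists (e / (c + 1)); first exact: divr_gt0.
move=> y; rewrite ltr_pdivlMr // => H'; apply: le_lt_trans (H _ _) _.
by have := enorm_ge0 (y - x); lra.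
Qed.

Lemma cvgvD u v (a b : 'rV[R]_k) :
  cvgv u a -> cvgv v b -> cvgv (fun j => u j + v j) (a + b).
Proof.
move=> Hu Hv e e0; have e2 : 0 < e / 2 by rewrite divr_gt0.
have [N HN] := Hu _ e2; have [M HM] := Hv _ e2.
exists (maxn N M) => j; rewrite geq_max => /andP[/HN H1 /HM H2].
by rewrite opprD addrACA; apply: le_lt_trans (ler_enormD _ _) _; lra.
Qed.

Lemma cvgv_continuous l (T : 'rV[R]_k -> 'rV[R]_l) u a :
  continuousv T -> cvgv u a -> cvgv (fun j => T (u j)) (T a).
Proof.
move=> HT Hu e e0; have [d d0 Hd] := HT a e e0.
by have [N HN] := Hu d d0; exists N => j /HN /Hd.
Qed.

Lemma archi_inv (e : R) : 0 < e -> exists N, forall j, (N <= j)%N -> (j.+1%:R : R)^-1 < e.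
Proof.
move=> e0; exists (Num.trunc e^-1) => j Hj.
rewrite invf_plt ?posrE ?ltr0n //.
have : e^-1 < (Num.trunc e^-1).+1%:R by exact: truncnS_gt.
by move=> /lt_le_trans; apply; rewrite ler_nat.
Qed.

Lemma cvgv_close u v a : cvgv u a -> (forall j, enorm (v j - u j) < j.+1%:R^-1) ->
  cvgv v a.
Proof.
move=> Hu H e e0; have e2 : 0 < e / 2 by rewrite divr_gt0.
have [N HN] := Hu _ e2; have [M HM] := archi_inv e2.
exists (maxn N M) => j; rewrite geq_max => /andP[/HN H1 /HM H2].
have H3 := lt_trans (H j) H2.
by apply: le_lt_trans (ler_enorm_dist (u j) _ _) _; lra.
Qed.

Lemma frechet_addr F G gG x w : is_gradient G gG -> frechet_subdiff F x w ->
  frechet_subdiff (fun z => F z + (G z)%:E)%E x (w + gG x).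
Proof.
move=> HG [Fx H]; split; first by rewrite fin_numD Fx.
move=> e e0; have e2 : 0 < e / 2 by rewrite divr_gt0.
have [d d0 Hd] := HG x _ e2; have [d' d'0 Hd'] := H _ e2.
exists (Num.min d d'); first by rewrite lt_min d0.
move=> y; rewrite lt_min => /andP[/Hd H1 /Hd' H2].
apply: (le_trans _ (leeD H2 (lexx _))); rewrite -EFinD lee_fin fineD //=.
by move: H1; rewrite ler_norml => /andP[H1 _]; rewrite dotvDl; lra.
Qed.

Lemma frechet_limiting F x w : frechet_subdiff F x w -> limiting_subdiff F x w.
Proof.
move=> H; exists (fun=> x), (fun=> w); split => //.
- by move=> e e0; exists 0%N => j _; rewrite subrr enorm0.
- by case: H.
- by move=> e e0; exists 0%N => j _; rewrite subrr normr0.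
- by move=> e e0; exists 0%N => j _; rewrite subrr enorm0.
Qed.

(** The Fréchet sum rule is applied along the approximating sequence; continuity of [G] preserves
    the convergence of values, and continuity of [gG] that of the subgradients. *)
Lemma limiting_addr F G gG x w : is_gradient G gG -> continuousv gG ->
  limiting_subdiff F x w ->
  limiting_subdiff (fun z => F z + (G z)%:E)%E x (w + gG x).
Proof.
move=> HG cG [xs [vs [cx Fx cF Hf cv]]].
exists xs, (fun j => vs j + gG (xs j)); split => //.
- by rewrite fin_numD Fx.
- move=> e e0; have e2 : 0 < e / 2 by rewrite divr_gt0.
  have [N HN] := cF _ e2; have [d d0 Hd] := gradient_continuous x HG e2.
  have [M HM] := cx _ d0; exists (maxn N M) => j.
  rewrite geq_max => /andP[/HN H1 /HM /Hd H2].
  have [Fxs _] := Hf j.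
  rewrite !fineD //= opprD addrACA.
  by apply: le_lt_trans (ler_normD _ _) _; lra.
- by move=> j; exact: frechet_addr.
- exact/cvgvD/cvgv_continuous.
Qed.

(** Diagonal argument: near each [(u j, v j)] pick a Fréchet pair whose point, value and subgradient
    are all within [j.+1%:R^-1]. *)
Lemma limiting_closed F u v a b : cvgv u a -> F a \is a fin_num ->
  (forall e : R, 0 < e -> exists N : nat, forall j, (N <= j)%N ->
     `|fine (F (u j)) - fine (F a)| < e) ->
  (forall j, limiting_subdiff F (u j) (v j)) -> cvgv v b ->
  limiting_subdiff F a b.
Proof.
move=> cu Fa cF Hl cv.
have /choice[p Hp] : forall j, exists p : 'rV[R]_k * 'rV[R]_k,
    [/\ enorm (p.1 - u j) < j.+1%:R^-1, `|fine (F p.1) - fine (F (u j))| < j.+1%:R^-1,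
        enorm (p.2 - v j) < j.+1%:R^-1 & frechet_subdiff F p.1 p.2].
  move=> j; have j0 : 0 < (j.+1%:R : R)^-1 by rewrite invr_gt0 ltr0n.
  have [xs [vs [cx _ cFx Hf cvx]]] := Hl j.
  have [N1 H1] := cx _ j0; have [N2 H2] := cFx _ j0; have [N3 H3] := cvx _ j0.
  pose N := maxn N1 (maxn N2 N3).
  exists (xs N, vs N); split; [apply: H1|apply: H2|apply: H3|exact: Hf];
    by rewrite !leq_max leqnn ?orbT.
exists (fun j => (p j).1), (fun j => (p j).2); split => //.
- by apply: cvgv_close cu _ => j; have [] := Hp j.
- move=> e e0; have e2 : 0 < e / 2 by rewrite divr_gt0.
  have [N HN] := cF _ e2; have [M HM] := archi_inv e2.
  exists (maxn N M) => j; rewrite geq_max => /andP[/HN H1 /HM H2].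
  have [_ /lt_trans /(_ H2) H3 _ _] := Hp j.
  rewrite -(subrK (fine (F (u j))) (fine (F (p j).1))) -addrA.
  by apply: le_lt_trans (ler_normD _ _) _; lra.
- by move=> j; have [] := Hp j.
- by apply: cvgv_close cv _ => j; have [] := Hp j.
Qed.

(** Fermat's rule for a proximal step. In the difference of the two Bregman terms only [G z - G p]
    is nonlinear, and its first-order expansion at [p] yields exactly the Fréchet inequality. *)
Lemma bregman_prox_frechet F G gG (c p w : 'rV[R]_k) : is_gradient G gG ->
  F p \is a fin_num ->
  (forall z, (F p + (dotv c p + bregman G gG p w)%:E
     <= F z + (dotv c z + bregman G gG z w)%:E)%E) ->
  frechet_subdiff F p (gG w - gG p - c).
Proof.
move=> HG Fp Hmin; split=> // e e0; have [d d0 Hd] := HG p e e0.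
exists d => // z /Hd; rewrite ler_norml => /andP[_ H].
have := Hmin z; rewrite -{1}(fineK Fp).
case: (F z) => [r| |] /=; [|by move=> _; rewrite leey|by rewrite -EFinD addNye leeNy_eq].
rewrite /bregman -!EFinD !lee_fin !dotvBl !(dotvBr _ _ (gG w)) !(dotvBr _ _ c).
by lra.
Qed.

End Subdifferential.

(** * Abstract convergence under the KL inequality *)

Section KLConvergence.
Variables (R : realType) (k : nat).

Lemma bounded_cluster (z : nat -> 'rV[R]_k) (r : R) : (forall j, enorm (z j) <= r) ->
  exists a, forall (e : R) N, 0 < e -> exists2 j, (N <= j)%N & enorm (z j - a) < e.
Proof.
move=> Hz.
have cA : compact [set v : 'rV[R]_k | forall i, `[- r, r]%classic (v ord0 i)].
  by apply: (@rV_compact R k (fun=> `[- r, r]%classic)) => i; exact: segment_compact.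
have FA : (z @ \oo) [set v : 'rV[R]_k | forall i, `[- r, r]%classic (v ord0 i)].
  exists 0%N => // j _ i /=; rewrite in_itv /= -ler_norml.
  exact: le_trans (coord_le_enorm _ _) (Hz j).
have [a [_ Ha]] := cA _ _ FA.
exists a => e N e0.
(* Balls of the ambient topology are taken in the max norm; this radius fits in the Euclidean ball
   of radius [e] because [k < k.+1 ^ 2], also for [k = 0]. *)
have e1 : 0 < e / k.+1%:R by rewrite divr_gt0.
have [|_ [[j /= Nj <-] Hj]] := Ha (z @` [set j | (N <= j)%N]) _ _ (nbhsx_ballx a _ e1).
  by exists N => // j Nj; exists j.
exists j => //; rewrite -(@ltr_pXn2r _ 2) ?nnegrE ?enorm_ge0 ?ltW //.
rewrite enorm_sqr; apply: (@le_lt_trans _ _ (k%:R * (e / k.+1%:R) ^+ 2)).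
  rewrite (_ : _ * _ = \sum_(i < k) (e / k.+1%:R) ^+ 2); last first.
    by rewrite sumr_const card_ord mulr_natl.
  apply: ler_sum => i _; rewrite -expr2 -real_normK ?num_real //.
  rewrite ler_pXn2r ?nnegrE ?normr_ge0 ?(ltW e1) // ltW //.
  by have [_ /(_ ord0 i)] := Hj; rewrite /ball /= distrC !mxE.
rewrite expr_div_n mulrCA -{2}[e ^+ 2]mulr1 ltr_pM2l ?exprn_gt0 //.
rewrite ltr_pdivrMr ?exprn_gt0 // mul1r -natrX ltr_nat.
by rewrite -{1}[k]expn1 (@leq_trans (k.+1 ^ 1)) // leq_pexp2l.
Qed.

(* The recursion [e j.+2 <= d j.+2 + A * e j.+1 + B * e j] has contraction factor
   [A + B], so a bound [X] on [e] improves to [(A + B) * X + eps * (1 - A - B)]. *)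
Lemma inertial_vanish (d e : nat -> R) (A B E : R) :
  0 <= A -> 0 <= B -> A + B < 1 -> (forall j, e j <= E) ->
  (forall j, e j.+2 <= d j.+2 + A * e j.+1 + B * e j) ->
  (forall eps : R, 0 < eps -> exists N, forall j, (N <= j)%N -> d j < eps) ->
  forall eps : R, 0 < eps -> exists N, forall j, (N <= j)%N -> e j < eps.
Proof.
move=> A0 B0 AB HE He Hd eps eps0.
have c0 : 0 < 1 - (A + B) by rewrite subr_gt0.
have [N0 HN0] := Hd _ (mulr_gt0 (divr_gt0 eps0 (@ltr0Sn R 1)) c0).
have iter n : exists N, forall j, (N <= j)%N -> e j <= (A + B) ^+ n * E + eps / 2.
  elim: n => [|n [N HN]].
    by exists 0%N => j _; rewrite mul1r; have := HE j; lra.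
  exists (maxn N N0).+2 => -[//|[//|j]]; rewrite !ltnS geq_max => /andP[Nj N0j].
  apply: le_trans (He j) _; rewrite exprS -mulrA.
  have := ler_wpM2l A0 (HN j.+1 (leqW Nj)); have := ler_wpM2l B0 (HN j Nj).
  by have := HN0 j.+2 (leqW (leqW N0j)); lra.
have [n Hn] : exists n, (A + B) ^+ n * E < eps / 2.
  have : (fun n => (A + B) ^+ n * E) @ \oo --> 0 * E.
    apply: cvgMl; apply: cvg_expr; rewrite ger0_norm //; lra.
  rewrite mul0r => /cvgrPdist_lt /(_ _ (divr_gt0 eps0 (@ltr0Sn R 1))) [n _ /(_ n (leqnn n))].
  by rewrite /= sub0r normrN => /(le_lt_trans (ler_norm _)) H; exists n.
by have [N HN] := iter n; exists N => j /HN; lra.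
Qed.

Lemma desingularizer_small (eta : \bar R) (p : R -> R) : (0 < eta)%E -> p 0 = 0 ->
  {within [set s : R | 0 <= s /\ (s%:E < eta)%E], continuous p} ->
  forall eps : R, 0 < eps -> exists2 s0 : R, 0 < s0 &
    forall s, 0 <= s -> s < s0 -> (s%:E < eta)%E /\ p s < eps.
Proof.
move=> eta0 p0 cp eps eps0.
(* A real bound below [eta]: [eta] itself when finite, 1 when infinite. *)
have [s1 s10 Hs1] : exists2 s1 : R, 0 < s1 & (s1%:E <= eta)%E.
  case: (eta) eta0 => [r|_|//]; last by exists 1; rewrite ?leey.
  by rewrite lte_fin => r0; exists r.
have /(_ 0 (conj (lexx _) eta0)) := (subspace_continuousP _ _).1 cp.
move=> /cvgrPdist_lt /(_ _ eps0) [s2 /= s20 Hs2].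
exists (Num.min s1 s2); first by rewrite lt_min s10.
move=> s sge; rewrite lt_min => /andP[ss1 ss2].
have seta : (s%:E < eta)%E by apply: lt_le_trans Hs1; rewrite lte_fin.
split=> //; have := Hs2 s; rewrite /= sub0r normrN ger0_norm // => /(_ ss2).
move=> /(_ (conj sge seta)); rewrite /from_subspace p0 sub0r normrN.
by apply: le_lt_trans (ler_norm _).
Qed.

Lemma dist0_le (S : set 'rV[R]_k) v : S v -> (dist0 S <= (enorm v)%:E)%E.
Proof. by move=> Sv; apply: ereal_inf_lbound; exists v. Qed.

(** Separates the finite-length argument from the algorithm. [l j] are the objective values and
    [d j] is meant as the distance from [z j.+1] to the extrapolated point it was computed from.
    Continuity of [F] enters only through the last hypothesis, along the sequence near a cluster
    point. *)
Lemma KL_convergence (F : 'rV[R]_k -> \bar R) (z : nat -> 'rV[R]_k) (l d : nat -> R)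
    (r a C A B : R) :
  KL_function F -> (forall j, F (z j) = (l j)%:E) -> (forall j, enorm (z j) <= r) ->
  0 < a -> (forall j, l j.+1 + a * d j ^+ 2 <= l j) -> (forall j, 0 <= d j) ->
  0 < C -> (forall j, exists2 v, limiting_subdiff F (z j.+1) v & enorm v <= C * d j) ->
  0 <= A -> 0 <= B -> A + B < 1 ->
  (forall j, enorm (z j.+3 - z j.+2) <=
     d j.+2 + A * enorm (z j.+2 - z j.+1) + B * enorm (z j.+1 - z j)) ->
  (forall p, (forall (e : R) N, 0 < e -> exists2 j, (N <= j)%N & enorm (z j - p) < e) ->
     F p \is a fin_num /\
     forall e : R, 0 < e -> exists2 s : R, 0 < s &
       forall j, enorm (z j - p) < s -> `|l j - fine (F p)| < e) ->
  (exists S : R, forall N, \sum_(j < N) enorm (z j.+1 - z j) <= S) /\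
  exists zs, cvgv z zs /\ critical_point F zs.
Proof.
move=> HKL Fz zr a0 ldec d0 C0 Hv A0 B0 AB He Hclus.
have [p Hp] := bounded_cluster zr.
have [Fp cF] := Hclus p Hp.
pose e j := enorm (z j.+1 - z j); pose ls := fine (F p).
have e0 j : 0 <= e j by exact: enorm_ge0.
have lS j : l j.+1 <= l j.
  by have := ldec j; have := mulr_ge0 (ltW a0) (sqr_ge0 (d j)); lra.
have lmono i j : (i <= j)%N -> l j <= l i.
  by move=> /subnK <-; elim: (j - i)%N => // n IH; apply: le_trans (lS _) IH.
have lge j : ls <= l j.
  apply/ler_addgt0Pr => eps eps0; have [s s0 Hs] := cF eps eps0.
  have [i ij /Hs] := Hp s j s0; rewrite ltr_norml => /andP[H _].
  by have := lmono _ _ ij; rewrite -/ls in H; lra.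
have lcvg eps : 0 < eps -> exists N, forall j, (N <= j)%N -> l j - ls < eps.
  move=> eps0; have [s s0 Hs] := cF eps eps0.
  have [i _ /Hs] := Hp s 0%N s0; rewrite ltr_norml => /andP[_ H].
  by exists i => j /lmono; rewrite -/ls in H; lra.
have dcvg eps : 0 < eps -> exists N, forall j, (N <= j)%N -> d j < eps.
  move=> eps0; have [N HN] := lcvg _ (mulr_gt0 a0 (exprn_gt0 2 eps0)).
  exists N => j /HN H; rewrite -(@ltr_pXn2r _ 2) ?nnegrE ?(ltW eps0) //.
  by rewrite -(ltr_pM2l a0); have := ldec j; have := lge j.+1; lra.
have ecvg : forall eps, 0 < eps -> exists N, forall j, (N <= j)%N -> e j < eps.
  apply: (inertial_vanish A0 B0 AB (E := 2 * r) _ He dcvg) => j.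
  apply: le_trans (ler_enormD _ _) _; rewrite enormN.
  by have := zr j; have := zr j.+1; lra.
have Fpdom : dom_ext F p by rewrite /dom_ext /= ltey; case: (F p) Fp.
have [_ [eta [delta [ph [[eta0 delta0] [cph conc] [ph0 phge] dph KL]]]]] := HKL p Fpdom.
have small := desingularizer_small eta0 ph0 cph.
pose M := C / a; have M0 : 0 < M by exact: divr_gt0.
pose P j := ph (l j - ls).
have sge j : 0 <= l j - ls by rewrite subr_ge0.
have step j : enorm (z j.+1 - p) < delta -> ((l j.+1 - ls)%:E < eta)%E ->
    2 * d j.+1 <= d j + M * (P j.+1 - P j.+2).
  (* At a zero gap the KL inequality is silent; the values are then stationary and sufficient
     decrease forces [d j.+1 = 0]. *)
  move=> zj lj; have [lz|lnz] := eqVneq (l j.+1) ls.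
    have l2 : l j.+2 = ls by apply/eqP; rewrite eq_le lge andbT -lz lS.
    have : a * d j.+1 ^+ 2 <= a * 0 by have := ldec j.+1; rewrite l2 lz; lra.
    rewrite ler_pM2l // => D0.
    have /eqP : d j.+1 ^+ 2 == 0 by rewrite eq_le D0 sqr_ge0.
    by move/eqP; rewrite sqrf_eq0 => /eqP ->; rewrite /P l2 lz subrr !mulr0 addr0.
  have lp : 0 < l j.+1 - ls by rewrite subr_gt0 lt_neqAle eq_sym lnz lge.
  have [dps _ ph'0] := dph _ lp lj.
  have EF : (F (z j.+1) - F p = (l j.+1 - ls)%:E)%E.
    by rewrite Fz -(fineK Fp) -EFinD.
  have := KL (z j.+1) zj; rewrite EF Fz -(fineK Fp) lte_fin -/ls.
  move=> /(_ _ _); rewrite -subr_gt0 => /(_ lp).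
  have -> : ((l j.+1)%:E < ls%:E + eta)%E.
    by case: (eta) lj => [x|_|//]; [rewrite !lte_fin; lra | rewrite addey // ltey].
  move=> /(_ isT); rewrite /= => KLj.
  have [v Sv vC] := Hv j.
  set D := derive1 ph (l j.+1 - ls) in KLj ph'0.
  have H1 : 1 <= D * (C * d j).
    rewrite -lee_fin; apply: le_trans KLj _; rewrite EFinM lee_pmul2l ?lte_fin //.
    by apply: le_trans (dist0_le Sv) _; rewrite lee_fin.
  have H2 : D * (l j.+1 - l j.+2) <= P j.+1 - P j.+2.
    have -> : l j.+1 - l j.+2 = (l j.+1 - ls) - (l j.+2 - ls) by ring.
    apply: concave_gradient => //; first by rewrite lerD2r.
    move=> t t01; apply: conc => //.
    by apply: le_lt_trans lj; rewrite lee_fin lerD2r.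
  have H3 : D * (a * d j.+1 ^+ 2) <= P j.+1 - P j.+2.
    by apply: le_trans H2; rewrite ler_pM2l //; have := ldec j.+1; lra.
  (* The unknown slope [D] cancels: multiply [H3] by [C * d j] and bound [D * (C * d j)] below by 1
     using [H1]. *)
  have H4 : d j.+1 ^+ 2 <= M * (P j.+1 - P j.+2) * d j.
    rewrite (_ : _ * d j = (P j.+1 - P j.+2) * (C * d j) / a); last first.
      by rewrite /M; field; rewrite gt_eqF.
    rewrite ler_pdivlMr //.
    have Cd : 0 <= C * d j by rewrite mulr_ge0 // ltW.
    have ad : 0 <= a * d j.+1 ^+ 2 by rewrite mulr_ge0 ?sqr_ge0 // ltW.
    by have := ler_wpM2r Cd H3; have := ler_wpM2l ad H1; lra.
  have PP : 0 <= M * (P j.+1 - P j.+2).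
    rewrite mulr_ge0 ?(ltW M0) //; apply: le_trans H3.
    by rewrite !mulr_ge0 ?sqr_ge0 // ltW.
  (* Arithmetic-geometric mean: four times a product is at most the square of the sum. *)
  rewrite -(@ler_pXn2r _ 2) ?nnegrE ?mulr_ge0 ?addr_ge0 //.
  by have := sqr_ge0 (d j - M * (P j.+1 - P j.+2)); move: H4; lra.
clearbody M; have M0' := ltW M0.
pose c := 1 - (A + B); have c0 : 0 < c by rewrite subr_gt0.
(* The potential of the overview at index [j.+2], so that [e j] makes sense from 0 on. *)
pose V j := d j.+1 + M * P j.+2 + (A + B) * e j.+1 + B * e j.
(* Of the two copies of [d j.+2] given by [step], one telescopes inside [V] and the other pays for
   the inertial recursion. *)
have Vdec j : enorm (z j.+2 - p) < delta -> ((l j.+2 - ls)%:E < eta)%E ->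
    c * e j.+2 <= V j - V j.+1.
  by move=> zj lj; have := step _ zj lj; have := He j; rewrite /V /c /e; lra.
have Vge j : ((l j.+2 - ls)%:E < eta)%E -> 0 <= V j.
  move=> lj; rewrite /V !addr_ge0 ?mulr_ge0 ?addr_ge0 //.
  by apply: phge; first exact: sge.
pose Phi j := c * enorm (z j.+2 - p) + V j.
have etaS i j : (i <= j)%N -> ((l i - ls)%:E < eta)%E -> ((l j - ls)%:E < eta)%E.
  by move=> ij; apply: le_lt_trans; rewrite lee_fin lerD2r lmono.
(* the ball of radius [delta] traps the sequence once [Phi] is small *)
have trap K : ((l K.+2 - ls)%:E < eta)%E -> Phi K < c * delta ->
    forall i, Phi (i + K)%N <= Phi K.
  move=> lK PK; elim=> // i IH; apply: le_trans (IH).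
  have li : ((l (i + K).+2 - ls)%:E < eta)%E by apply: etaS lK; rewrite !ltnS leq_addl.
  have zi : enorm (z (i + K).+2 - p) < delta.
    rewrite -(ltr_pM2l c0); apply: le_lt_trans (PK); apply: le_trans IH.
    by rewrite lerDl Vge.
  have := Vdec _ zi li; rewrite /Phi addSn.
  have := ler_enorm_dist (z (i + K).+2) (z (i + K).+3) p.
  by rewrite -(ler_pM2l c0) -/(e _) mulrDr; lra.
have start eps : 0 < eps -> exists K, ((l K.+2 - ls)%:E < eta)%E /\ Phi K < eps.
  (* [Phi] has five terms, each made smaller than [eps / 5]: all but the distance to [p] are small
     at every late index, and the cluster property supplies a late index where that distance is
     small too. *)
  move=> eps0; have q0 : 0 < eps / 5 by rewrite divr_gt0.
  have [s0 s00 Hs] := small _ (divr_gt0 q0 M0).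
  have [N1 HN1] := lcvg _ s00; have [N2 HN2] := dcvg _ q0.
  have [N3 HN3] := ecvg _ q0.
  have [j] := Hp (eps / 5 / c) (maxn N1 (maxn N2 N3)).+2 (divr_gt0 q0 c0).
  case: j => [//|[//|j]]; rewrite !ltnS !geq_max => /and3P[j1 j2 j3] zj; exists j.
  have [etaj Pj] := Hs _ (sge j.+2) (HN1 _ (leqW (leqW j1))).
  split=> //; move: Pj; rewrite ltr_pdivlMr // -/(P _) => Pj.
  have h2 : d j.+1 < eps / 5 by exact/HN2/leqW.
  have h3 : e j < eps / 5 by exact: HN3.
  have h4 : e j.+1 < eps / 5 by exact/HN3/leqW.
  have h5 : (A + B) * e j.+1 <= e j.+1 by rewrite ler_piMl // ltW.
  have h6 : B * e j <= e j by rewrite ler_piMl //; lra.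
  by move: zj; rewrite ltr_pdivlMr // /Phi /V; lra.
have [K [lK PK]] := start _ (mulr_gt0 c0 delta0).
split.
  (* The steps before the trap are summed as they are; the later ones telescope against [V], which
     stays nonnegative. *)
  exists (\sum_(j < K.+2) e j + V K / c) => N.
  apply: (@le_trans _ _ (\sum_(j < K.+2 + N) e j)).
    rewrite addnC big_split_ord /= lerDl; apply: sumr_ge0 => j _; exact: e0.
  rewrite big_split_ord /= lerD2l ler_pdivlMr // mulrC.
  suff : c * \sum_(j < N) e (K.+2 + j)%N <= V K - V (N + K)%N.
    by have := Vge (N + K)%N; rewrite (etaS _ _ _ lK) ?ltnS ?leq_addl // => /(_ isT); lra.
  elim: N => [|N IH]; first by rewrite big_ord0 mulr0 add0n subrr.
  rewrite big_ord_recr /= mulrDr.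
  have lN : ((l (N + K).+2 - ls)%:E < eta)%E by apply: etaS lK; rewrite !ltnS leq_addl.
  have zN : enorm (z (N + K).+2 - p) < delta.
    rewrite -(ltr_pM2l c0); apply: le_lt_trans (PK); apply: le_trans (trap _ lK PK N).
    by rewrite lerDl Vge.
  have := Vdec _ zN lN; rewrite (_ : (K.+2 + N = (N + K).+2)%N); last by rewrite addnC !addnS.
  by rewrite addSn; lra.
have zcvg : cvgv z p.
  move=> eps eps0.
  (* Restart the trap at a smaller level: [delta] keeps the trap valid, [eps] gives convergence of
     the whole sequence to the cluster point. *)
  have [|K' [lK' PK']] := start (c * Num.min eps delta).
    by rewrite mulr_gt0 // lt_min eps0.
  have PK'd : Phi K' < c * delta.
    by apply: lt_le_trans PK' _; rewrite ler_pM2l // ge_min lexx orbT.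
  exists K'.+2 => -[//|[//|j]]; rewrite !ltnS => /subnK Hj.
  rewrite -(ltr_pM2l c0); apply: (@lt_le_trans _ _ (c * Num.min eps delta)).
    apply: le_lt_trans (PK'); rewrite -Hj; apply: le_trans (trap _ lK' PK'd (j - K')%N).
    by rewrite lerDl Vge // (etaS _ _ _ lK') // !ltnS leq_addl.
  by rewrite ler_pM2l // ge_min lexx.
exists p; split=> //.
have /choice[v Sv] : forall j, exists v, limiting_subdiff F (z j.+1) v /\ enorm v <= C * d j.
  by move=> j; have [v] := Hv j; exists v.
(* The subgradients of norm at most [C * d j] tend to 0, and so does the gap [l j.+1 - ls], as
   closedness of the limiting subdifferential requires. *)
apply: (limiting_closed (u := fun j => z j.+1) (v := v)) => //.
- by move=> eps eps0; have [N HN] := zcvg _ eps0; exists N => j /leqW /HN.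
- move=> eps eps0; have [N HN] := lcvg _ eps0; exists N => j /leqW /HN.
  by rewrite Fz /= -/ls ger0_norm.
- by move=> j; have [] := Sv j.
- move=> eps eps0; have [N HN] := dcvg _ (divr_gt0 eps0 C0); exists N => j /HN.
  by rewrite subr0 ltr_pdivlMr // mulrC; have [_] := Sv j; apply: le_lt_trans.
Qed.

End KLConvergence.

(** * The smooth part of the objective on the product space *)

Section Product.
Variables (R : realType) (n m : nat).
Variables (f : 'rV[R]_n -> R) (gf : 'rV[R]_n -> 'rV[R]_n).
Variables (g : 'rV[R]_m -> R) (gg : 'rV[R]_m -> 'rV[R]_m).

Lemma enorm_lsubmx_le (z : 'rV[R]_(n + m)) : enorm (lsubmx z) <= enorm z.
Proof. by rewrite -{2}(pairv_sub z) enorm_pairv_gel. Qed.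

Lemma enorm_rsubmx_le (z : 'rV[R]_(n + m)) : enorm (rsubmx z) <= enorm z.
Proof. by rewrite -{2}(pairv_sub z) enorm_pairv_ger. Qed.

Lemma is_gradient_pair : is_gradient f gf -> is_gradient g gg ->
  is_gradient (fun z : 'rV[R]_(n + m) => f (lsubmx z) + g (rsubmx z))
    (fun z => pairv (gf (lsubmx z)) (gg (rsubmx z))).
Proof.
move=> Hf Hg z e e0; have e2 : 0 < e / 2 by rewrite divr_gt0.
have [d d0 Hd] := Hf (lsubmx z) _ e2; have [d' d'0 Hd'] := Hg (rsubmx z) _ e2.
exists (Num.min d d'); first by rewrite lt_min d0.
move=> w; rewrite lt_min => /andP[H H'].
have Hl := enorm_lsubmx_le (w - z); have Hr := enorm_rsubmx_le (w - z).
have := Hd _ (le_lt_trans (_ : enorm (lsubmx w - lsubmx z) <= _) H).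
have := Hd' _ (le_lt_trans (_ : enorm (rsubmx w - rsubmx z) <= _) H').
rewrite -!linearB => /(_ Hr) H2 /(_ Hl) H1.
rewrite -[X in dotv _ X]pairv_sub dotv_pairv.
rewrite (_ : _ - _ = (f (lsubmx w) - f (lsubmx z) - dotv (gf (lsubmx z)) (lsubmx (w - z)))
  + (g (rsubmx w) - g (rsubmx z) - dotv (gg (rsubmx z)) (rsubmx (w - z)))); last by ring.
have := ler_wpM2l (ltW e2) Hl; have := ler_wpM2l (ltW e2) Hr.
by move=> H3 H4; apply: le_trans (ler_normD _ _) _; lra.
Qed.

Lemma lipschitzv_pair (Lf Lg : R) : lipschitzv gf Lf -> lipschitzv gg Lg ->
  lipschitzv (fun z : 'rV[R]_(n + m) => pairv (gf (lsubmx z)) (gg (rsubmx z))) (Lf + Lg).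
Proof.
move=> [Lf0 Hf] [Lg0 Hg]; split; first exact: addr_ge0.
move=> z w; rewrite pairvB; apply: le_trans (enorm_pairv_le _ _) _.
have := ler_wpM2l Lf0 (enorm_lsubmx_le (z - w)).
have := ler_wpM2l Lg0 (enorm_rsubmx_le (z - w)).
have := Hf (lsubmx z) (lsubmx w); have := Hg (rsubmx z) (rsubmx w).
by rewrite -!linearB; lra.
Qed.

Lemma Lobj_uncurryv (Q : 'rV[R]_n -> 'rV[R]_m -> \bar R) :
  uncurryv (Lobj f Q g) =
  (fun z => uncurryv Q z + (f (lsubmx z) + g (rsubmx z))%:E)%E.
Proof. by apply/funext => z; rewrite /uncurryv /Lobj EFinD addeAC addeC. Qed.

End Product.

(** Compare the minimizer with the base point [w], whose Bregman term vanishes: strong convexity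
    gains [theta / 2], the descent lemma for [G] costs [L / 2]. It serves for both blocks. *)
Lemma bregman_prox_descent (R : realType) k (F : 'rV[R]_k -> \bar R)
    (G P : 'rV[R]_k -> R) (gG gP : 'rV[R]_k -> 'rV[R]_k) (L theta : R) (p w : 'rV[R]_k) :
  is_gradient G gG -> lipschitzv gG L -> is_gradient P gP -> strongly_convex theta P ->
  F p \is a fin_num -> F w \is a fin_num ->
  (F p + (dotv (gG w) p + bregman P gP p w)%:E
     <= F w + (dotv (gG w) w + bregman P gP w w)%:E)%E ->
  fine (F p) + G p + (theta - L) / 2 * enorm (p - w) ^+ 2 <= fine (F w) + G w.
Proof.
move=> HG LG HP SP Fp Fw; rewrite -{1}(fineK Fp) -{1}(fineK Fw) -!EFinD lee_fin.
have -> : bregman P gP w w = 0 by rewrite /bregman dotvBr !subrr.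
have := descent_lemma HG LG w p; have := bregman_ge HP SP p w.
by rewrite dotvBr; lra.
Qed.

Lemma nneseries_bounded_lty (R : realType) (u : nat -> R) (S : R) :
  (forall j, 0 <= u j) -> (forall N, \sum_(j < N) u j <= S) ->
  (\sum_(0 <= j <oo) (u j)%:E < +oo)%E.
Proof.
move=> u0 HS; apply: (@le_lt_trans _ _ S%:E); last exact: ltey.
apply: lime_le.
  by apply: is_cvg_nneseries => j _ _; rewrite lee_fin.
by apply: nearW => N; rewrite sumEFin lee_fin big_mkord.
Qed.

(** * Verification of the abstract hypotheses for the algorithm *)

Unset Implicit Arguments.
Theorem theorem3p1 (R : realType) (n m : nat)
  (f : 'rV[R]_n -> R) (gf : 'rV[R]_n -> 'rV[R]_n)
  (g : 'rV[R]_m -> R) (gg : 'rV[R]_m -> 'rV[R]_m)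
  (Q : 'rV[R]_n -> 'rV[R]_m -> \bar R)
  (Lf Lg : R)
  (phi1 : 'rV[R]_n -> R) (gphi1 : 'rV[R]_n -> 'rV[R]_n)
  (phi2 : 'rV[R]_m -> R) (gphi2 : 'rV[R]_m -> 'rV[R]_m)
  (theta1 theta2 eta1 eta2 : R)
  (q : 'rV[R]_n -> 'rV[R]_m -> R) (gxq : 'rV[R]_n -> 'rV[R]_m -> 'rV[R]_n)
  (h : 'rV[R]_n -> \bar R)
  (* (A1) *)
  (HLbdd : exists c : R, forall x y, (c%:E <= Lobj f Q g x y)%E)
  (Hgf : is_gradient f gf) (HLipf : lipschitzv gf Lf)
  (Hgg : is_gradient g gg) (HLipg : lipschitzv gg Lg)
  (HQproper : proper_ext (uncurryv Q)) (HQlsc : lsc_ext (uncurryv Q))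
  (Hphi1 : is_gradient phi1 gphi1) (Hsc1 : strongly_convex theta1 phi1)
  (Htheta1 : Lf < theta1) (HLipphi1 : lipschitzv gphi1 eta1)
  (Hphi2 : is_gradient phi2 gphi2) (Hsc2 : strongly_convex theta2 phi2)
  (Htheta2 : Lg < theta2) (HLipphi2 : lipschitzv gphi2 eta2)
  (* (A2) *)
  (Hcoer : coercive_ext (uncurryv (Lobj f Q g)))
  (HdomQ : closedv (dom_ext (uncurryv Q)))
  (Hpartial : forall x y, (Q x y < +oo)%E -> forall vx vy,
      limiting_subdiff (fun x' => Q x' y) x vx ->
      limiting_subdiff (fun y' => Q x y') y vy ->
      limiting_subdiff (uncurryv Q) (pairv x y) (pairv vx vy))
  (HQdec : forall x y, Q x y = ((q x y)%:E + h x)%E)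
  (Hh : continuous_on_set (fun x => fine (h x)) (dom_ext h))
  (Hq : continuous_on_set (uncurryv q) (dom_ext (uncurryv Q)))
  (Hqx : forall y, is_gradient (fun x => q x y) (fun x => gxq x y) /\
                   continuousv (fun x => gxq x y))
  (HqLip : forall (D1 : set 'rV[R]_n) (D2 : set 'rV[R]_m),
      boundedv [set z | D1 (lsubmx z) /\ D2 (rsubmx z)] ->
      (forall x y, D1 x -> D2 y -> (Q x y < +oo)%E) ->
      exists2 xi : R, 0 < xi & forall xb y yb, D1 xb -> D2 y -> D2 yb ->
        enorm (gxq xb y - gxq xb yb) <= xi * enorm (y - yb))
  (* KL *)
  (HKL : KL_function (uncurryv (Lobj f Q g)))
  (* the algorithm *)
  (amax bmax : R) (alpha beta : nat -> R)
  (x : nat -> 'rV[R]_n) (y : nat -> 'rV[R]_m)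
  (xh : nat -> 'rV[R]_n) (yh : nat -> 'rV[R]_m)
  (xm1 : 'rV[R]_n) (ym1 : 'rV[R]_m)
  (Hamax : 0 <= amax) (Hbmax : 0 <= bmax) (Hab : amax + bmax < 1)
  (Halpha : forall k, 0 <= alpha k <= amax) (Hbeta : forall k, 0 <= beta k <= bmax)
  (Hxh0 : xh 0%N = x 0%N) (Hyh0 : yh 0%N = y 0%N)
  (Hxstep : forall k x',
      (Q (x k.+1) (yh k) + (dotv (gf (xh k)) (x k.+1) + bregman phi1 gphi1 (x k.+1) (xh k))%:E
       <= Q x' (yh k) + (dotv (gf (xh k)) x' + bregman phi1 gphi1 x' (xh k))%:E)%E)
  (Hystep : forall k y',
      (Q (x k.+1) (y k.+1) + (dotv (gg (yh k)) (y k.+1) + bregman phi2 gphi2 (y k.+1) (yh k))%:E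
       <= Q (x k.+1) y' + (dotv (gg (yh k)) y' + bregman phi2 gphi2 y' (yh k))%:E)%E)
  (Hextra : forall k,
      let u := x k.+1 + alpha k *: (x k.+1 - x k) + beta k *: (x k - prevseq x xm1 k) in
      let v := y k.+1 + alpha k *: (y k.+1 - y k) + beta k *: (y k - prevseq y ym1 k) in
      (xh k.+1, yh k.+1) =
        if (Lobj f Q g u v <= Lobj f Q g (x k.+1) (y k.+1))%E then (u, v)
        else (x k.+1, y k.+1)) :
  (\sum_(0 <= k <oo) (enorm (pairv (x k.+1) (y k.+1) - pairv (x k) (y k)))%:E < +oo)%E /\
  exists zs : 'rV[R]_(n + m),
    cvgv (fun k => pairv (x k) (y k)) zs /\ critical_point (uncurryv (Lobj f Q g)) zs.
Proof.
have [QNy [w0 Qw0]] := HQproper.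
have hNy a : h a != -oo%E.
  have := QNy (pairv a 0); rewrite uncurryv_pairv HQdec.
  by case: (h a).
have domh a b : (Q a b < +oo)%E = (h a < +oo)%E.
  rewrite HQdec; case: (h a) => [t| |]; first by rewrite -EFinD !ltey.
    by rewrite addey.
  by rewrite addeNy.
have QE a b : (h a < +oo)%E -> Q a b = (q a b + fine (h a))%:E.
  by rewrite HQdec; case: (h a) (hNy a).
have Qfin a b : (h a < +oo)%E -> Q a b \is a fin_num by move=> /QE ->.
(* Real-valued version of the objective. It is meaningful only where [h] is finite, as [fine] sends
   infinity to 0. *)
pose lo a b := f a + (q a b + fine (h a)) + g b.
have LE a b : (h a < +oo)%E -> Lobj f Q g a b = (lo a b)%:E.
  by move=> ha; rewrite /Lobj QE.
have domL a b : (Lobj f Q g a b < +oo)%E -> (h a < +oo)%E.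
  by rewrite -(domh a b) /Lobj; case: (Q a b) => [t| |] //; rewrite !ltey.
(* Minimality against a point of the domain makes every [x k.+1] feasible. *)
have hx k : (h (x k.+1) < +oo)%E.
  have hw : (h (lsubmx w0) < +oo)%E by rewrite -(domh _ (rsubmx w0)).
  rewrite -(domh _ (yh k)); have := Hxstep k (lsubmx w0); rewrite (QE _ _ hw).
  by case: (Q (x k.+1) (yh k)) => [t| |] //; rewrite ?ltey // addye.
(* Acceptance of an extrapolated point bounds its value by a finite one, hence also places it in the
   domain. *)
have Hhat k : (h (xh k.+1) < +oo)%E /\ lo (xh k.+1) (yh k.+1) <= lo (x k.+1) (y k.+1).
  move: (Hextra k); rewrite /=; case: ifP => [H|_] [-> ->]; last by split.
  have hu : (h (x k.+1 + alpha k *: (x k.+1 - x k) +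
                beta k *: (x k - prevseq x xm1 k))%R < +oo)%E.
    by apply: domL; apply: le_lt_trans H _; rewrite (LE _ _ (hx k)) ltey.
  by split=> //; move: H; rewrite (LE _ _ hu) (LE _ _ (hx k)) lee_fin.
(* Everything is shifted by one, as the starting point may be infeasible: [z 0] is the first
   computed iterate. *)
pose z k := pairv (x k.+1) (y k.+1); pose zh k := pairv (xh k.+1) (yh k.+1).
pose l k := lo (x k.+1) (y k.+1); pose d k := enorm (z k.+1 - zh k).
have Fz k : uncurryv (Lobj f Q g) (z k) = (l k)%:E by rewrite uncurryv_pairv LE.
pose a := Num.min ((theta1 - Lf) / 2) ((theta2 - Lg) / 2).
have a0 : 0 < a by rewrite lt_min !divr_gt0 ?subr_gt0.
have a1 : a <= (theta1 - Lf) / 2 by rewrite ge_min lexx.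
have a2 : a <= (theta2 - Lg) / 2 by rewrite ge_min lexx orbT.
(* The two block descents telescope through the intermediate point [(x k.+2, yh k.+1)]. *)
have ldec k : l k.+1 + a * d k ^+ 2 <= l k.
  have [hu Hu] := Hhat k; apply: le_trans Hu.
  have := bregman_prox_descent (F := fun x' => Q x' (yh k.+1)) Hgf HLipf Hphi1 Hsc1
    (Qfin _ _ (hx k.+1)) (Qfin _ _ hu) (Hxstep k.+1 _).
  have := bregman_prox_descent (F := Q (x k.+2)) Hgg HLipg Hphi2 Hsc2
    (Qfin _ _ (hx k.+1)) (Qfin _ _ (hx k.+1)) (Hystep k.+1 _).
  rewrite /= !QE //= /d /z /zh pairvB enorm_pairv_sqr.
  have := ler_wpM2r (sqr_ge0 (enorm (x k.+2 - xh k.+1))) a1.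
  have := ler_wpM2r (sqr_ge0 (enorm (y k.+2 - yh k.+1))) a2.
  by rewrite /l /lo; lra.
have l0 k : l k <= l 0%N.
  elim: k => // k; apply: le_trans.
  by have := ldec k; have := mulr_ge0 (ltW a0) (sqr_ge0 (d k)); lra.
have [r Hr] := Hcoer (l 0%N).
have zr k : enorm (z k) <= r.
  by rewrite leNgt; apply/negP => /Hr; rewrite Fz lte_fin ltNge l0.
have zhr k : enorm (zh k) <= r.
  rewrite leNgt; apply/negP => /Hr; have [hu Hu] := Hhat k.
  by rewrite uncurryv_pairv LE // lte_fin ltNge (le_trans Hu (l0 k)).
pose D1 := [set u | exists k, u = x k.+1].
(* Both kinds of second component are collected, because the gradients of [q] are compared between
   [yh k.+1] and [y k.+2]. *)
pose D2 := [set v | (exists k, v = y k.+1) \/ (exists k, v = yh k.+1)].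
have D12 : boundedv [set w : 'rV[R]_(n + m) | D1 (lsubmx w) /\ D2 (rsubmx w)].
  exists (r + r) => w [/= [i Hi] Hj]; rewrite -(pairv_sub w).
  apply: le_trans (enorm_pairv_le _ _) _; apply: lerD.
    by rewrite Hi; apply: le_trans (zr i); exact: enorm_pairv_gel.
  by case: Hj => [] [j ->]; [apply: le_trans (zr j)|apply: le_trans (zhr j)];
    exact: enorm_pairv_ger.
have D12dom u v : D1 u -> D2 v -> (Q u v < +oo)%E by move=> [i ->] _; rewrite domh.
have [xi xi0 Hxi] := HqLip D1 D2 D12 D12dom.
have [Lf0 Hf'] := HLipf; have [Lg0 Hg'] := HLipg.
have [e10 He1] := HLipphi1; have [e20 He2] := HLipphi2.
pose C := eta1 + Lf + xi + (eta2 + Lg).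
have C0 : 0 < C by rewrite /C; lra.
have Hgrad := is_gradient_pair Hgf Hgg.
have cgrad := lipschitzv_continuous (lipschitzv_pair HLipf HLipg).
have Hsub k : exists2 v, limiting_subdiff (uncurryv (Lobj f Q g)) (z k.+1) v &
    enorm v <= C * d k.
  have Fx := bregman_prox_frechet (F := fun x' => Q x' (yh k.+1)) Hphi1
    (Qfin _ _ (hx k.+1)) (Hxstep k.+1).
  have Fy := bregman_prox_frechet (F := Q (x k.+2)) Hphi2
    (Qfin _ _ (hx k.+1)) (Hystep k.+1).
  (* Adding the smooth function [q(., y k.+2) - q(., yh k.+1)] turns [Q(., yh k.+1)] into
     [Q(., y k.+2)], also where [h] is infinite. *)
  have Gq := is_gradientB (Hqx (y k.+2)).1 (Hqx (yh k.+1)).1.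
  have {}Fx := frechet_addr Gq Fx; rewrite /= in Fx.
  rewrite (_ : (fun _ => _) = (fun x' => Q x' (y k.+2))) in Fx; last first.
    apply/funext => x'; rewrite !HQdec.
    by case: (h x') => [t| |] //=; rewrite -!EFinD; congr _%:E; ring.
  (* Both partial subgradients now live at the same point, so they combine into one of [Q]; the
     gradients of [f] and [g] are added afterwards. *)
  have := Hpartial (x k.+2) (y k.+2); rewrite domh => /(_ (hx k.+1)).
  move=> /(_ _ _ (frechet_limiting Fx) (frechet_limiting Fy)).
  move=> /(limiting_addr Hgrad cgrad); rewrite -Lobj_uncurryv /pairv row_mxKl row_mxKr.
  rewrite -!/(pairv _ _) pairvD => Hv; eexists; first exact: Hv.
  apply: le_trans (enorm_pairv_le _ _) _.
  have dx : enorm (x k.+2 - xh k.+1) <= d k.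
    by rewrite /d /z /zh pairvB; exact: enorm_pairv_gel.
  have dy : enorm (y k.+2 - yh k.+1) <= d k.
    by rewrite /d /z /zh pairvB; exact: enorm_pairv_ger.
  have := He1 (xh k.+1) (x k.+2); rewrite enormC (enormC (xh _)) => A1.
  have := Hf' (x k.+2) (xh k.+1) => A2.
  have A3 : enorm (gxq (x k.+2) (y k.+2) - gxq (x k.+2) (yh k.+1)) <=
      xi * enorm (y k.+2 - yh k.+1).
    by apply: Hxi; [exists k.+1|left; exists k.+1|right; exists k].
  have := He2 (yh k.+1) (y k.+2); rewrite enormC (enormC (yh _)) => A4.
  have := Hg' (y k.+2) (yh k.+1) => A5.
  have := ler_wpM2l e10 dx; have := ler_wpM2l Lf0 dx; have := ler_wpM2l (ltW xi0) dy.
  have := ler_wpM2l e20 dy; have := ler_wpM2l Lg0 dy.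
  have B1 : enorm (gphi1 (xh k.+1) - gphi1 (x k.+2) - gf (xh k.+1) +
      (gxq (x k.+2) (y k.+2) - gxq (x k.+2) (yh k.+1)) + gf (x k.+2)) <=
      enorm (gphi1 (x k.+2) - gphi1 (xh k.+1)) + enorm (gf (x k.+2) - gf (xh k.+1)) +
      enorm (gxq (x k.+2) (y k.+2) - gxq (x k.+2) (yh k.+1)).
    rewrite (enormC (gphi1 _)).
    rewrite (_ : _ + gf _ = (gphi1 (xh k.+1) - gphi1 (x k.+2)) +
      (gf (x k.+2) - gf (xh k.+1)) +
      (gxq (x k.+2) (y k.+2) - gxq (x k.+2) (yh k.+1))); last first.
      by apply/rowP => i; rewrite !mxE; ring.
    by apply: le_trans (ler_enormD _ _) _; rewrite lerD2r ler_enormD.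
  have B2 : enorm (gphi2 (yh k.+1) - gphi2 (y k.+2) - gg (yh k.+1) + gg (y k.+2)) <=
      enorm (gphi2 (y k.+2) - gphi2 (yh k.+1)) + enorm (gg (y k.+2) - gg (yh k.+1)).
    by rewrite (enormC (gphi2 _)) -addrA (addrC (- _) (gg _)) ler_enormD.
  by rewrite /C; lra.
have He k : enorm (z k.+3 - z k.+2) <=
    d k.+2 + amax * enorm (z k.+2 - z k.+1) + bmax * enorm (z k.+1 - z k).
  have /andP[al0 al1] := Halpha k.+2; have /andP[be0 be1] := Hbeta k.+2.
  have n1 := enorm_ge0 (z k.+2 - z k.+1); have n2 := enorm_ge0 (z k.+1 - z k).
  (* Pass through the extrapolated point: its offset from [z k.+2] is the inertial combination if
     accepted, and zero otherwise. *)
  apply: le_trans (ler_enorm_dist (zh k.+2) _ _) _; rewrite -addrA lerD2l.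
  have := Hextra k.+2; rewrite /=; case: ifP => _ [Ex Ey].
    rewrite (_ : zh k.+2 - z k.+2 = alpha k.+2 *: (z k.+2 - z k.+1) +
      beta k.+2 *: (z k.+1 - z k)); last first.
      rewrite /zh Ex Ey /z !pairvB !pairvZ pairvD.
      by congr pairv; apply/rowP => i; rewrite !mxE; ring.
    apply: le_trans (ler_enormD _ _) _; rewrite !enormZ !ger0_norm //.
    by apply: lerD; apply: ler_wpM2r.
  by rewrite /zh Ex Ey subrr enorm0 addr_ge0 // mulr_ge0.
have Hclus p : (forall (e : R) N, 0 < e -> exists2 j, (N <= j)%N & enorm (z j - p) < e) ->
    uncurryv (Lobj f Q g) p \is a fin_num /\
    forall e : R, 0 < e -> exists2 s : R, 0 < s &
      forall j, enorm (z j - p) < s -> `|l j - fine (uncurryv (Lobj f Q g) p)| < e.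
  move=> Hp.
  (* Closedness of the domain makes [p] feasible; the smooth part, [q] and [h] are then continuous
     along feasible points, each contributing less than [e / 4]. *)
  have Qp : dom_ext (uncurryv Q) p.
    apply: HdomQ => e e0; have [j _ Hj] := Hp e 0%N e0.
    by exists (z j) => //; rewrite /dom_ext /= uncurryv_pairv domh.
  have hp : (h (lsubmx p) < +oo)%E by rewrite -(domh _ (rsubmx p)).
  have Fp : uncurryv (Lobj f Q g) p = (lo (lsubmx p) (rsubmx p))%:E by exact: LE.
  rewrite Fp; split=> // e e0 /=.
  have e4 : 0 < e / 4 by rewrite divr_gt0.
  have [s1 s10 H1] := gradient_continuous p Hgrad e4.
  have [s2 s20 H2] := Hq p _ Qp e4.
  have [s3 s30 H3] := Hh _ _ hp e4.
  exists (Num.min s1 (Num.min s2 s3)); first by rewrite !lt_min s10 s20.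
  move=> j; rewrite !lt_min => /and3P[/H1 {}H1 {}/H2 H2 Hj].
  have Qj : dom_ext (uncurryv Q) (z j) by rewrite /dom_ext /= uncurryv_pairv domh.
  have {}H3 := H3 (x j.+1) (hx j).
  have /H3 {}H3 : enorm (x j.+1 - lsubmx p) < s3.
    apply: le_lt_trans Hj; rewrite -{2}(pairv_sub p) pairvB.
    exact: enorm_pairv_gel.
  move: H1 (H2 Qj) H3.
  rewrite uncurryv_pairv /z /pairv row_mxKl row_mxKr /uncurryv /l /lo.
  move=> H1 H4 H3.
  rewrite (_ : _ - _ = (f (x j.+1) + g (y j.+1) - (f (lsubmx p) + g (rsubmx p))) +
    (q (x j.+1) (y j.+1) - q (lsubmx p) (rsubmx p)) +
    (fine (h (x j.+1)) - fine (h (lsubmx p)))); last by ring.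
  apply: le_lt_trans (ler_normD _ _) _.
  by have := ler_normD (f (x j.+1) + g (y j.+1) - (f (lsubmx p) + g (rsubmx p)))
    (q (x j.+1) (y j.+1) - q (lsubmx p) (rsubmx p)); lra.
have [[S HS] [zs [czs crit]]] := KL_convergence HKL Fz zr a0 ldec
  (fun k => enorm_ge0 _) C0 Hsub Hamax Hbmax Hab He Hclus.
split; last first.
  exists zs; split=> // e e0; have [N HN] := czs e e0.
  by exists N.+1 => -[//|j] Hj; exact: HN.
(* The shift left out the step from the starting point, which is put back as the first term of the
   bound. *)
apply: (@nneseries_bounded_lty _ _ (enorm (z 0%N - pairv (x 0%N) (y 0%N)) + S)).
  by move=> j; exact: enorm_ge0.
case=> [|N].
  rewrite big_ord0 addr_ge0 ?enorm_ge0 //.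
  by have := HS 0%N; rewrite big_ord0.
rewrite big_ord_recl /= lerD2l; exact: HS.
Qed.
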